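(* Let $\mathbb{F}_q$ be a finite field of characteristic at least $5$ with $q\equiv -1\pmod 3$. Let $A\in\mathbb{F}_q[x]$ with $\deg(A)=n_1$ and let $B=a(a^2-A)+\kappa$, where $a\in\mathbb{F}_q[x]$ with $\deg(a)>n_1/2$ and $\kappa\in\mathbb{F}_q^*$. Set $D=4A^3-27B^2$ and suppose that the squarefree factorization of $D$ is $D=D_1D_2^2$ and that $D_2\mid B$. Let $\mathcal{F}=\mathbb{F}_q(x,y)$ with $y^3=Ay-B$ and suppose that $T^3-AT+B$ is irreducible over $\mathbb{F}_q(x)$. Then $\mathcal{F}$ has unit rank $1$ and $\epsilon=a+y$ is a fundamental unit.
   Context: $\mathbb{F}_q$ is assumed to be algebraically closed in $\mathcal{F}$. ''The squarefree factorization of $D$ is $D=D_1D_2^2$'' means $D_1,D_2\in\mathbb{F}_q[x]$ are squarefree and coprime. $\mathcal{O}$ is the integral closure of $\mathbb{F}_q[x]$ in $\mathcal{F}$; $\mathcal{O}^*=\mathbb{F}_q^*\times\mathcal{E}$ with $\mathcal{E}$ free abelian of finite rank, this rank being the unit rank; if the unit rank is $1$, a fundamental unit is a unit generating $\mathcal{O}^*$ modulo $\mathbb{F}_q^*$. *)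

(* Defs.v *)
From HB Require Import structures.
From mathcomp Require Import all_boot all_order all_algebra all_field.

Set Implicit Arguments.
Unset Strict Implicit.
Unset Printing Implicit Defensive.

Import GRing.Theory.
Local Open Scope ring_scope.

(* The zero polynomial is not squarefree, and nonzero constants are. *)
Definition squarefree_poly (K : fieldType) (p : {poly K}) : Prop :=
  forall d : {poly K}, d ^+ 2 %| p -> size d = 1%N.

Definition squarefree_factorization (K : fieldType) (D D1 D2 : {poly K}) :
    Prop :=
  [/\ D = D1 * D2 ^+ 2, squarefree_poly D1, squarefree_poly D2
    & coprimep D1 D2].

Section FunctionField.

(* A function field is given as a finite extension L of K(x), with K(x)
   realized as the fraction field of {poly K}. *)
Variables (K : fieldType) (L : fieldExtType {fraction {poly K}}).

Definition poly_emb : {poly K} -> L := in_alg L \o @tofrac {poly K}.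
HB.instance Definition _ := GRing.RMorphism.on poly_emb.

Definition const_emb : K -> L := poly_emb \o polyC.
HB.instance Definition _ := GRing.RMorphism.on const_emb.

Definition const_field_closed : Prop :=
  forall z : L, algebraicOver const_emb z -> exists c : K, z = const_emb c.

Definition in_max_order (z : L) : Prop := integralOver poly_emb z.

Definition order_unit (u : L) : Prop :=
  in_max_order u /\ exists2 v : L, in_max_order v & u * v = 1.

Definition unit_subgroup (E : L -> Prop) : Prop :=
  [/\ forall u, E u -> order_unit u, E 1,
      forall u v, E u -> E v -> E (u * v) & forall u, E u -> E u^-1].

(* Every element of E is uniquely a product of integer powers of the e i,
   i.e. the e i form a basis of the multiplicative abelian group E. *)
Definition free_of_rank (E : L -> Prop) (r : nat) : Prop :=
  exists e : 'I_r -> L, (forall i, E (e i)) /\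
    forall u, E u -> exists! k : {ffun 'I_r -> int}, u = \prod_i e i ^ k i.

(* The group of units of the maximal order is the internal direct product of
   the group of nonzero constants and a free abelian group of rank r. *)
Definition has_unit_rank (r : nat) : Prop :=
  exists E : L -> Prop,
    [/\ unit_subgroup E,
        forall u, order_unit u ->
          exists2 c : K, c != 0 & exists2 v : L, E v & u = const_emb c * v,
        forall c : K, E (const_emb c) -> c = 1
      & free_of_rank E r].

Definition fundamental_unit (u : L) : Prop :=
  order_unit u /\
  forall v : L, order_unit v ->
    exists2 c : K, c != 0 & exists k : int, v = const_emb c * u ^ k.

End FunctionField.

(* Main.v *)
Require Import Defs.
From mathcomp Require Import all_boot all_order all_algebra all_field.
From mathcomp Require Import generic_quotient ring zify.

Set Implicit Arguments.
Unset Strict Implicit.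
Unset Printing Implicit Defensive.

Import GRing.Theory.
Local Open Scope ring_scope.

(** Put e = a + y and m = deg a. Then
      e^3 = 3 a e^2 - (3 a^2 - A) e - kappa,
    so e is a unit. Two facts show that every unit is a constant times a power
    of e.

    The first is that the maximal order is F_q[x][y] ([integral_in_order]).
    It is enough to rule out an irreducible denominator P. If
    (f0 + f1 y + f2 y^2) / P is integral, replacing a basis vector by it in
    the Gram matrix of the trace form, whose determinant is D, shows that P^2
    divides every f_i^2 D ([index_square_dvd_disc]). So P divides all the f_i
    unless P^2 divides D, that is, unless P divides D2. In that case P divides
    A and divides B exactly once, because D is free of cubes at P and D2
    divides B; the cubic is then Eisenstein at P, and norms show that P divides
    the f_i all the same ([eisenstein_dvd]). The norm of an integral element is
    a polynomial because its powers have a common denominator and the norm is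
    multiplicative ([integral_norm]); traces are combinations of norms
    ([integral_trace]).

    The second is a descent at infinity. Every unit is r + s e + t e^2 with
    polynomial coordinates; measure it by
      n = max (deg r, m + deg s, 2 m + deg t),
    its largest pole order at the infinite places. As deg A < 2 m, the
    coefficients in degree n multiply as in
      F_q[T] / (T^3 - 3 T^2 + 3 T) = F_q x F_q[T] / (T^2 - 3 T + 3),
    where the second factor is a field because q = 2 mod 3 leaves no primitive
    cube root of unity in F_q. Let z z' = 1 with measures n, n' > 0. The
    leading parts of z and z' have product 0 and are not 0, so one of them, say
    that of z, vanishes in the first factor, and that of z' vanishes in the
    second. Comparing constant coordinates in z z' = 1 then yields
    deg r <= n - 3 m, so that z / e has measure at most n - m, while z' e has
    measure at most n' + m - 1 ([unit_div_mul_bounds]). Hence the sum of the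
    two measures drops until one of them is 0, and that element is a constant
    ([unit_power]).

    Finally no nontrivial power of e is a constant: otherwise e would be
    algebraic over F_q, hence itself a constant, against the independence of 1
    and y ([power_const_exp0]). *)

(** * Irreducible factors in K[x] *)

(** Over a finite field irreducibility is decided by enumeration, so a reducible
    polynomial comes with a proper factor. *)
Lemma irreducible_factor (K : finFieldType) (f : {poly K}) :
  (1 < size f)%N -> exists2 P, irreducible_poly P & P %| f.
Proof.
have [n] := ubnP (size f); elim: n f => // n IHn f le_fn f1.
have f0 : f != 0 by rewrite -size_poly_gt0 ltnW.
have [irr | ] := boolP (irreducibleb f).
  by exists f => //; apply/irreducibleP.
rewrite /irreducibleb f1 /= => /forallPn[/= q].
rewrite negb_imply -Pdiv.Idomain.dvdpE -ltnNge => /andP[qf q1].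
have [P irrP Pq] : exists2 P, irreducible_poly P & P %| (q : {poly K}).
  apply: IHn q1; apply: leq_ltn_trans (size_npoly q) _.
  by rewrite prednK // ltnW.
by exists P => //; apply: dvdp_trans qf.
Qed.

Section IrreducibleFactors.
Variable K : fieldType.
Implicit Types P f g A B D : {poly K}.

Lemma irreducible_dvdM P f g :
  irreducible_poly P -> P %| f * g -> (P %| f) || (P %| g).
Proof.
move=> irrP; have [//|nPf] := boolP (P %| f).
by rewrite Gauss_dvdpr ?irreducible_poly_coprime.
Qed.

Lemma irreducible_dvdX P f n : irreducible_poly P -> P %| f ^+ n -> P %| f.
Proof.
move=> irrP; elim: n => [|n IH]; last first.
  by rewrite exprS => /(irreducible_dvdM irrP)/orP[].
by rewrite expr0 dvdp1 => /eqP sP; have := irrP.1; rewrite sP.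
Qed.

Lemma squarefree_irreducible P f :
  irreducible_poly P -> squarefree_poly f -> ~~ (P ^+ 2 %| f).
Proof. by move=> irrP sf; apply/negP=> /sf sP; have := irrP.1; rewrite sP. Qed.

Lemma dvd_square_part P D D1 D2 : irreducible_poly P ->
  squarefree_factorization D D1 D2 -> P ^+ 2 %| D -> P %| D2.
Proof.
move=> irrP [-> sf1 _ _]; apply: contraTT => nPD2.
rewrite Gauss_dvdpl ?squarefree_irreducible //.
by rewrite coprimep_expl // coprimep_expr // irreducible_poly_coprime.
Qed.

Lemma square_part_cube_free P D D1 D2 : irreducible_poly P ->
  squarefree_factorization D D1 D2 -> P %| D2 -> ~~ (P ^+ 3 %| D).
Proof.
move=> irrP [-> _ sf2 cop] PD2; have P0 := irredp_neq0 irrP.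
have [e eD2] := dvdpP _ _ PD2.
have -> : D1 * D2 ^+ 2 = (D1 * e ^+ 2) * P ^+ 2 by rewrite eD2; ring.
rewrite exprS dvdp_mul2r ?expf_neq0 //.
apply/negP=> /(irreducible_dvdM irrP)/orP[PD1 | /(irreducible_dvdX irrP) Pe].
  have := coprimepP _ _ cop P PD1 PD2; rewrite -size_poly_eq1 => /eqP sP.
  by have := irrP.1; rewrite sP.
have := squarefree_irreducible irrP sf2; rewrite eD2 expr2 dvdp_mul2r //.
by rewrite Pe.
Qed.

(** From P^2 | D and P^2 | B^2 one gets P | A; a second factor P in B would put
    P^3 into both terms of D. *)
Lemma square_part_eisenstein P A B D D1 D2 : 2%:R != 0 :> K ->
    irreducible_poly P -> D = 4%:R * A ^+ 3 - 27%:R * B ^+ 2 ->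
    squarefree_factorization D D1 D2 -> D2 %| B -> P %| D2 ->
  P %| A /\ ~~ (P ^+ 2 %| B).
Proof.
move=> two0 irrP hD sf D2B PD2; have PB := dvdp_trans PD2 D2B.
have P2D : P ^+ 2 %| D.
  by case: sf => -> _ _ _; apply: dvdp_mull; apply: dvdp_exp2r.
have four : 4%:R != 0 :> K by rewrite (natrM _ 2 2) mulf_neq0.
have PA : P %| A.
  apply: (irreducible_dvdX (n := 3) irrP).
  rewrite -(dvdpZr _ _ four) scaler_nat -mulr_natl.
  have -> : 4%:R * A ^+ 3 = D + 27%:R * B ^+ 2 by rewrite hD; ring.
  apply: dvdp_add; first by apply: dvdp_trans P2D; rewrite expr2 dvdp_mulIl.
  by apply: dvdp_mull; rewrite expr2 dvdp_mulr.
split=> //; apply/negP=> P2B.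
have := square_part_cube_free irrP sf PD2; rewrite hD dvdp_sub //.
  by apply: dvdp_mull; apply: dvdp_exp2r.
apply: dvdp_mull; apply: (@dvdp_trans _ (P ^+ 4)); first exact: dvdp_exp2l.
by rewrite (exprM P 2 2) dvdp_exp2r.
Qed.

End IrreducibleFactors.

(** * Polynomials inside a field of fractions *)

Lemma fraction_div (R : idomainType) (u : {fraction R}) :
  exists n d : R, d != 0 /\ u = tofrac n / tofrac d.
Proof.
elim/quotW: u => -[[n d] /= d0]; exists n, d; split=> //.
rewrite !piE; apply/eqmodP=> /=; rewrite FracField.equivfE /=.
rewrite /FracField.mulf /FracField.invf.
by rewrite !numden_Ratio ?mulr1 ?mul1r ?oner_eq0 //= mulrC.
Qed.

(** The field K(x) enters only up to isomorphism, as a field containing a copy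
    of K[x] whose quotients exhaust it. *)
Section FractionField.
Variables (K F : fieldType) (emb : {rmorphism {poly K} -> F}).
Hypothesis emb_inj : injective emb.
Hypothesis emb_frac : forall u : F, exists n d, d != 0 /\ u = emb n / emb d.
Implicit Types (n d f g v : {poly K}) (u : F).

Lemma emb_eq0 f : (emb f == 0) = (f == 0).
Proof. by rewrite -(rmorph0 emb) (inj_eq emb_inj). Qed.

Lemma frac_coprime u :
  exists n d, [/\ d != 0, coprimep n d & u = emb n / emb d].
Proof.
have [n [d [d0 ->]]] := emb_frac u.
have g0 : gcdp n d != 0 by rewrite gcdp_eq0 negb_and d0 orbT.
have dE := divpK (dvdp_gcdr n d); have nE := divpK (dvdp_gcdl n d).
have d'0 : d %/ gcdp n d != 0.
  by apply: contraNneq d0 => e; rewrite -dE e mul0r.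
exists (n %/ gcdp n d), (d %/ gcdp n d); split=> //.
  by apply: coprimep_div_gcd; rewrite d0 orbT.
rewrite -[in LHS]nE -[X in _ / emb X]dE !rmorphM -mulf_div divff ?mulr1 //.
by rewrite emb_eq0.
Qed.

Definition is_poly u := exists f, u = emb f.

Lemma is_poly_emb f : is_poly (emb f). Proof. by exists f. Qed.

Lemma is_polyD u u' : is_poly u -> is_poly u' -> is_poly (u + u').
Proof. by move=> [f ->] [g ->]; exists (f + g); rewrite rmorphD. Qed.

Lemma is_polyB u u' : is_poly u -> is_poly u' -> is_poly (u - u').
Proof. by move=> [f ->] [g ->]; exists (f - g); rewrite rmorphB. Qed.

Lemma is_polyM u u' : is_poly u -> is_poly u' -> is_poly (u * u').
Proof. by move=> [f ->] [g ->]; exists (f * g); rewrite rmorphM. Qed.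

Lemma dvdp_is_poly f v : v != 0 -> is_poly (emb f / emb v) -> v %| f.
Proof.
move=> v0 [g e]; apply/dvdpP; exists g; apply: emb_inj.
by rewrite rmorphM -e divfK // emb_eq0.
Qed.

(** Write u = n / v in lowest terms: v^j divides d for all j, which forces v to
    be constant. *)
Lemma is_poly_of_powers d u : d != 0 ->
  (forall j, is_poly (emb d * u ^+ j)) -> is_poly u.
Proof.
move=> d0 Hu; have [n [v [v0 nv uE]]] := frac_coprime u.
have vF0 : emb v != 0 by rewrite emb_eq0.
have dvd_d j : v ^+ j %| d.
  have : v ^+ j %| d * n ^+ j.
    apply: dvdp_is_poly; first exact: expf_neq0.
    by have := Hu j; rewrite uE expr_div_n rmorphM !rmorphXn mulrA.
  rewrite mulrC Gauss_dvdpr // coprimep_expl // coprimep_expr //.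
  by rewrite coprimep_sym.
have : (size (v ^+ size d) <= size d)%N by apply: dvdp_leq.
have [sv | sv] := leqP (size v) 1.
  move=> _; have /size_poly1P[c c0 vE] : size v == 1%N.
    by rewrite eqn_leq sv size_poly_gt0.
  exists (c^-1 *: n); rewrite uE; apply: (mulIf vF0); rewrite divfK //.
  by rewrite -rmorphM vE mulrC mul_polyC scalerA divff // scale1r.
move=> le; suff : (size d < size (v ^+ size d))%N by rewrite ltnNge le.
have -> : size (v ^+ size d) = ((size v).-1 * size d).+1.
  by rewrite -size_exp prednK // size_poly_gt0 expf_neq0.
by rewrite ltnS leq_pmull // -subn1 subn_gt0.
Qed.

End FractionField.

(** * Coordinates in a cubic extension *)

Definition quadratic (R : Type) (L : nzRingType) (phi : R -> L) (y : L)
    (r s t : R) : L :=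
  phi r + phi s * y + phi t * y ^+ 2.

Lemma size_cubic_tail (R : nzRingType) (a b : R) :
  (size (- (a%:P * 'X) + b%:P)%R < 4)%N.
Proof.
rewrite (leq_ltn_trans (size_polyD _ _)) // gtn_max.
rewrite size_polyN (leq_ltn_trans (size_polyMleq _ _)) ?size_polyX ?addn2 /=.
  by rewrite ltnS (leq_trans (size_polyC_leq1 _)).
by rewrite !ltnS (leq_trans (size_polyC_leq1 _)).
Qed.

Section CubicExtension.
Variables (F : fieldType) (L : fieldExtType F) (A B : F) (y : L).
Local Notation cubic := ('X^3 - A%:P * 'X + B%:P : {poly F}).
Hypothesis irr_cubic : irreducible_poly cubic.
Hypothesis gen_y : (<<1; y>> = fullv)%VS.
Hypothesis y_cubic : y ^+ 3 = in_alg L A * y - in_alg L B.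

Local Notation comb := (quadratic (in_alg L) y).

Lemma size_cubic : size cubic = 4%N.
Proof. by rewrite -addrA size_polyDl size_polyXn // size_cubic_tail. Qed.

Lemma root_cubic : (map_poly (in_alg L) cubic).[y] = 0.
Proof.
rewrite rmorphD rmorphB /= map_polyXn rmorphM /= map_polyX !map_polyC.
by rewrite !hornerE y_cubic; ring.
Qed.

Lemma comb_poly (q : {poly F}) : (size q <= 3)%N ->
  (map_poly (in_alg L) q).[y] = comb q`_0 q`_1 q`_2.
Proof.
move=> sq; rewrite (@horner_coef_wide _ 3) ?size_map_poly //.
by rewrite !big_ord_recl big_ord0 !coef_map /= expr0 expr1 mulr1 addr0 addrA.
Qed.

Lemma comb_surj z : exists r s t, z = comb r s t.
Proof.
have : z \in <<1; y>>%VS by rewrite gen_y memvf.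
case/Fadjoin1_polyP=> q ->.
rewrite (divp_eq q cubic) rmorphD rmorphM /= hornerD hornerM root_cubic mulr0.
rewrite add0r comb_poly; first by do 3 eexists.
by rewrite -ltnS -size_cubic ltn_modp -size_poly_gt0 size_cubic.
Qed.

Lemma comb_eq0 r s t : comb r s t = 0 -> [/\ r = 0, s = 0 & t = 0].
Proof.
pose q : {poly F} := Poly [:: r; s; t].
have sq : (size q <= 3)%N by apply: size_Poly.
have qE : (map_poly (in_alg L) q).[y] = comb r s t.
  by rewrite comb_poly // !coef_Poly.
have [q0 | qn0] := eqVneq q 0.
  move=> _; have := congr1 (fun p : {poly F} => (p`_0, p`_1, p`_2)) q0.
  by rewrite !coef_Poly /= !coef0 => -[-> -> ->].
move=> e; have : coprimep cubic q.
  rewrite irreducible_poly_coprime //; apply: contraTN sq => /dvdp_leq-/(_ qn0).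
  by rewrite size_cubic ltnNge.
case/Bezout_eq1_coprimepP=> -[u v] /=.
move/(congr1 (fun p => (map_poly (in_alg L) p).[y])).
rewrite rmorphD !rmorphM rmorph1 hornerD !hornerM root_cubic qE e.
by rewrite !mulr0 addr0 hornerC => /eqP; rewrite eq_sym oner_eq0.
Qed.

Lemma comb_inj r s t r' s' t' : comb r s t = comb r' s' t' ->
  [/\ r = r', s = s' & t = t'].
Proof.
move=> e; have : comb (r - r') (s - s') (t - t') = 0.
  by move: e => /eqP; rewrite -subr_eq0 => /eqP <-; rewrite /quadratic; ring.
by case/comb_eq0=> /subr0_eq-> /subr0_eq-> /subr0_eq->.
Qed.

Lemma combM r s t r' s' t' : comb r s t * comb r' s' t' =
  comb (r * r' - B * (s * t' + t * s'))
   (r * s' + s * r' + A * (s * t' + t * s') - B * (t * t'))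
   (r * t' + s * s' + t * r' + A * (t * t')).
Proof. by rewrite /quadratic; ring: y_cubic. Qed.

End CubicExtension.

(** * Norms and traces of integral elements *)

(** The norm of r + s y + t y^2 when y^3 = A y - B: the determinant of
    multiplication by this element in the basis 1, y, y^2. *)
Definition cubic_norm (R : comNzRingType) (A B r s t : R) : R :=
  r ^+ 3 + 2%:R * A * r ^+ 2 * t - A * r * s ^+ 2 + A ^+ 2 * r * t ^+ 2
  + 3%:R * B * r * s * t - B * s ^+ 3 + A * B * s * t ^+ 2 + B ^+ 2 * t ^+ 3.

Section IntegralCoordinates.
Variables (K F : fieldType) (emb : {rmorphism {poly K} -> F}).
Hypothesis emb_inj : injective emb.
Hypothesis emb_frac : forall u : F, exists n d, d != 0 /\ u = emb n / emb d.
Hypothesis two0 : 2%:R != 0 :> K.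
Variables (L : fieldExtType F) (A B : {poly K}) (y : L).
Hypothesis irr_cubic :
  irreducible_poly ('X^3 - (emb A)%:P * 'X + (emb B)%:P : {poly F}).
Hypothesis gen_y : (<<1; y>> = fullv)%VS.
Hypothesis y_cubic : y ^+ 3 = in_alg L (emb A) * y - in_alg L (emb B).

Local Notation embL := (in_alg L \o emb).
Local Notation comb := (quadratic (in_alg L) y).
Local Notation norm := (cubic_norm (emb A) (emb B)).

Lemma normM r s t r' s' t' r'' s'' t'' :
  comb r s t * comb r' s' t' = comb r'' s'' t'' ->
  norm r'' s'' t'' = norm r s t * norm r' s' t'.
Proof.
rewrite (combM y_cubic) => /(comb_inj irr_cubic y_cubic)[<- <- <-].
by rewrite /cubic_norm; ring.
Qed.

Lemma comb1 : comb 1 0 0 = 1.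
Proof. by rewrite /quadratic !rmorph0 rmorph1 !mul0r !addr0. Qed.

Lemma combZ c r s t : in_alg L c * comb r s t = comb (c * r) (c * s) (c * t).
Proof. by rewrite /quadratic; ring. Qed.

Lemma norm_exp r s t j r' s' t' :
  comb r s t ^+ j = comb r' s' t' -> norm r' s' t' = norm r s t ^+ j.
Proof.
elim: j r' s' t' => [|j IHj] r' s' t'.
  rewrite expr0 -comb1 => /(comb_inj irr_cubic y_cubic)[<- <- <-].
  by rewrite /cubic_norm; ring.
have [r1 [s1 [t1 e]]] := comb_surj gen_y y_cubic (comb r s t ^+ j).
by rewrite exprS e => /normM->; rewrite (IHj _ _ _ e) exprS.
Qed.

Definition in_order z := exists r s t, z = comb (emb r) (emb s) (emb t).

Lemma in_orderD z z' : in_order z -> in_order z' -> in_order (z + z').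
Proof.
move=> [r [s [t ->]]] [r' [s' [t' ->]]].
by exists (r + r'), (s + s'), (t + t'); rewrite /quadratic; ring.
Qed.

Lemma in_orderM z z' : in_order z -> in_order z' -> in_order (z * z').
Proof.
move=> [r [s [t ->]]] [r' [s' [t' ->]]].
exists (r * r' - B * (s * t' + t * s')),
  (r * s' + s * r' + A * (s * t' + t * s') - B * (t * t')),
  (r * t' + s * s' + t * r' + A * (t * t')).
by rewrite (combM y_cubic); congr comb; ring.
Qed.

Lemma in_order_emb f : in_order (embL f).
Proof. by exists f, 0, 0; rewrite /quadratic !rmorph0 !mul0r !addr0. Qed.

Lemma embL1 : embL 1 = 1.
Proof. by rewrite /= rmorph1 scale1r. Qed.

Lemma in_order1 : in_order 1.
Proof. by exists 1, 0, 0; rewrite !rmorph0 rmorph1 comb1. Qed.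

Lemma in_order0 : in_order 0.
Proof. by exists 0, 0, 0; rewrite /quadratic !rmorph0 !mul0r !addr0. Qed.

Lemma in_orderX z j : in_order z -> in_order (z ^+ j).
Proof.
move=> Oz; elim: j => [|j IH]; first exact: in_order1.
by rewrite exprS; apply: in_orderM.
Qed.

Lemma in_order_sum (I : Type) (s : seq I) (P : pred I) (G : I -> L) :
  (forall i, in_order (G i)) -> in_order (\sum_(i <- s | P i) G i).
Proof.
move=> OG; apply: big_ind => //; [exact: in_order0 | exact: in_orderD].
Qed.

Lemma common_denominator z :
  exists2 v : {poly K}, v != 0 & in_order (embL v * z).
Proof.
have [r [s [t ->]]] := comb_surj gen_y y_cubic z.
have [n1 [d1 [d10 ->]]] := emb_frac r.
have [n2 [d2 [d20 ->]]] := emb_frac s.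
have [n3 [d3 [d30 ->]]] := emb_frac t.
exists (d1 * d2 * d3); first by rewrite !mulf_neq0.
exists (n1 * d2 * d3), (d1 * n2 * d3), (d1 * d2 * n3).
rewrite combZ; have nz := emb_eq0 emb_inj.
by congr comb; rewrite !rmorphM; field; rewrite nz.
Qed.

(** If z satisfies a monic equation of degree k and v z is in K[x][y], then
    v^k clears z^j for j < k, and the equation reduces the higher powers to
    these. *)
Lemma bounded_powers (z : L) : integralOver embL z ->
  exists2 d : {poly K}, d != 0 & forall j, in_order (embL d * z ^+ j).
Proof.
case=> q mon_q qz0; have [v v0 Ovz] := common_denominator z.
pose k := (size q).-1.
have sq : size q = k.+1 by rewrite prednK // size_poly_gt0 monic_neq0.
have qk : q`_k = 1 by apply/eqP; rewrite -monicE.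
have zk : z ^+ k = - \sum_(i < k) embL q`_i * z ^+ i.
  move: qz0 => /rootP; rewrite (@horner_coef_wide _ k.+1); last first.
    by rewrite -sq; apply: size_poly.
  rewrite big_ord_recr /= coef_map qk.
  rewrite -[X in _ + X * _ = 0]/(embL 1) embL1 mul1r => /eqP.
  rewrite addrC addr_eq0 => /eqP->.
  by congr (- _); apply: eq_bigr => i _; rewrite coef_map.
exists (v ^+ k); first exact: expf_neq0.
elim/ltn_ind => j IHj; have [lt_jk | le_kj] := ltnP j k.
  have -> : embL (v ^+ k) * z ^+ j = embL (v ^+ (k - j)) * (embL v * z) ^+ j.
    by rewrite exprMn -rmorphXn mulrA -rmorphM -exprD subnK // ltnW.
  by apply: in_orderM; [apply: in_order_emb | apply: in_orderX].
have -> : embL (v ^+ k) * z ^+ j =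
    \sum_(i < k) embL (- q`_i) * (embL (v ^+ k) * z ^+ (i + (j - k))).
  rewrite -{1}(subnKC le_kj) exprD zk mulNr mulr_suml -sumrN mulr_sumr.
  by apply: eq_bigr => i _; rewrite rmorphN exprD; ring.
apply: in_order_sum => i; apply: in_orderM; first exact: in_order_emb.
by apply: IHj; rewrite -{2}(subnKC le_kj) ltn_add2r.
Qed.

(** If d clears every power z^j, then d^3 N(z)^j is a polynomial for all j,
    being the norm of d z^j. *)
Lemma integral_norm r s t :
  integralOver embL (comb r s t) -> is_poly emb (norm r s t).
Proof.
case/bounded_powers=> d d0 Od.
apply: (is_poly_of_powers emb_inj emb_frac (expf_neq0 3 d0)) => j.
have [r' [s' [t' e]]] := Od j.
have [r1 [s1 [t1 e1]]] := comb_surj gen_y y_cubic (comb r s t ^+ j).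
move: e; rewrite e1 combZ => /(comb_inj irr_cubic y_cubic)[er es et].
exists (cubic_norm A B r' s' t').
rewrite -(norm_exp e1).
transitivity (norm (emb r') (emb s') (emb t'));
  last by rewrite /cubic_norm; ring.
by rewrite -er -es -et /cubic_norm; ring.
Qed.

Lemma integral_y : integralOver embL y.
Proof.
exists ('X^3 - A%:P * 'X + B%:P).
  rewrite -addrA monicE lead_coefDl ?lead_coefXn //.
  by rewrite size_polyXn size_cubic_tail.
apply/rootP; rewrite rmorphD rmorphB /= map_polyXn rmorphM /= map_polyX.
by rewrite !map_polyC !hornerE y_cubic /=; ring.
Qed.

(** N(z + c) is monic of degree 3 in c with second coefficient the trace
    3 r + 2 A t, so N(z + 1) + N(z - 1) - 2 N(z) is twice the trace. *)
Lemma integral_trace r s t :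
  integralOver embL (comb r s t) -> is_poly emb (3%:R * r + 2%:R * emb A * t).
Proof.
move=> int_z; have int1 := integral1 embL.
have /integral_norm Np : integralOver embL (comb (r + 1) s t).
  have -> : comb (r + 1) s t = comb r s t + 1 by rewrite /quadratic; ring.
  exact: integral_add.
have /integral_norm Nm : integralOver embL (comb (r - 1) s t).
  have -> : comb (r - 1) s t = comb r s t - 1 by rewrite /quadratic; ring.
  exact: integral_sub.
have N0 := integral_norm int_z.
have h : 2%:R != 0 :> F.
  by rewrite -(rmorph_nat emb) emb_eq0 // -polyC_natr polyC_eq0.
have inv2 : 2%:R * emb (2%:R^-1)%:P = 1.
  by rewrite -(rmorph_nat emb) -rmorphM -polyC_natr -polyCM divff // rmorph1.
have -> : 3%:R * r + 2%:R * emb A * t = emb (2%:R^-1)%:P *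
    (norm (r + 1) s t + norm (r - 1) s t - (norm r s t + norm r s t)).
  by apply: (mulfI h); rewrite mulrA inv2 /cubic_norm; ring.
apply: is_polyM; first exact: is_poly_emb.
by apply: is_polyB; apply: is_polyD.
Qed.

End IntegralCoordinates.

(** * The maximal order is generated by y *)

Section MaximalOrder.
Variables (K F : fieldType) (emb : {rmorphism {poly K} -> F}).
Hypothesis emb_inj : injective emb.
Hypothesis emb_frac : forall u : F, exists n d, d != 0 /\ u = emb n / emb d.
Hypothesis two0 : 2%:R != 0 :> K.
Variables (L : fieldExtType F) (A B : {poly K}) (y : L).
Hypothesis irr_cubic :
  irreducible_poly ('X^3 - (emb A)%:P * 'X + (emb B)%:P : {poly F}).
Hypothesis gen_y : (<<1; y>> = fullv)%VS.
Hypothesis y_cubic : y ^+ 3 = in_alg L (emb A) * y - in_alg L (emb B).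

Local Notation embL := (in_alg L \o emb).
Local Notation comb := (quadratic (in_alg L) y).
Local Notation D := (4%:R * A ^+ 3 - 27%:R * B ^+ 2).

Let int_norm := integral_norm emb_inj emb_frac irr_cubic gen_y y_cubic.
Let int_trace :=
  integral_trace emb_inj emb_frac two0 irr_cubic gen_y y_cubic.
Let int_y := integral_y y_cubic.

Lemma in_order_integral r s t :
  integralOver embL (comb (emb r) (emb s) (emb t)).
Proof.
have int_emb f : integralOver embL (embL f) by apply: integral_id.
rewrite /quadratic expr2; apply: integral_add.
  exact: integral_add (int_emb r) (integral_mul (int_emb s) int_y).
exact: integral_mul (int_emb t) (integral_mul int_y int_y).
Qed.

Section Denominator.
Variables (P f0 f1 f2 : {poly K}).
Hypothesis irrP : irreducible_poly P.
Local Notation coord f := (emb f / emb P).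
Hypothesis int_z : integralOver embL (comb (coord f0) (coord f1) (coord f2)).

Let P0 : emb P != 0. Proof. by rewrite emb_eq0 ?irredp_neq0. Qed.

(** The discriminant argument. With z the given element and g = P z, the
    traces h_i of g y^i are divisible by P and the trace Q of g^2 by P^2.
    Replacing one vector of the basis 1, y, y^2 by g multiplies the
    discriminant by f_i^2 and leaves a Gram matrix with determinant divisible
    by P^2. *)
Lemma index_square_dvd_disc :
  [\/ P ^+ 2 %| D | [/\ P %| f0, P %| f1 & P %| f2]].
Proof.
pose h0 := 3%:R * f0 + 2%:R * A * f2.
pose h1 := 2%:R * A * f1 - 3%:R * B * f2.
pose h2 := 2%:R * A * f0 - 3%:R * B * f1 + 2%:R * A ^+ 2 * f2.
pose Q := f0 * h0 + f1 * h1 + f2 * h2.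
have P0p := irredp_neq0 irrP.
have Ph0 : P %| h0.
  apply: (dvdp_is_poly emb_inj P0p).
  have -> : coord h0 = 3%:R * coord f0 + 2%:R * emb A * coord f2.
    by rewrite /h0; field.
  exact: int_trace int_z.
have Ph1 : P %| h1.
  apply: (dvdp_is_poly emb_inj P0p).
  have := integral_mul int_z int_y.
  have -> : comb (coord f0) (coord f1) (coord f2) * y =
      comb (- emb B * coord f2) (coord f0 + emb A * coord f2) (coord f1).
    by rewrite /quadratic; ring: y_cubic.
  by move/int_trace; congr (is_poly _ _); rewrite /h1; field.
have Ph2 : P %| h2.
  apply: (dvdp_is_poly emb_inj P0p).
  have := integral_mul (integral_mul int_z int_y) int_y.
  have -> : comb (coord f0) (coord f1) (coord f2) * y * y =
      comb (- emb B * coord f1) (emb A * coord f1 - emb B * coord f2)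
        (coord f0 + emb A * coord f2).
    by rewrite /quadratic; ring: y_cubic.
  by move/int_trace; congr (is_poly _ _); rewrite /h2; field.
have PQ : P ^+ 2 %| Q.
  apply: (dvdp_is_poly emb_inj (expf_neq0 2 P0p)).
  have := integral_mul int_z int_z; rewrite (combM y_cubic).
  by move/int_trace; congr (is_poly _ _); rewrite /Q /h0 /h1 /h2; field.
have PPhh h h' : P %| h -> P %| h' -> P ^+ 2 %| h * h'.
  by move=> Ph Ph'; rewrite expr2 dvdp_mul.
(* Expansions of the determinants of the three modified Gram matrices. *)
have gram0 : P ^+ 2 %| f0 ^+ 2 * D.
  have -> : f0 ^+ 2 * D = (4%:R * A ^+ 3 - 9%:R * B ^+ 2) * Q
    - (2%:R * A ^+ 2) * (h1 * h1) - (6%:R * B) * (h1 * h2)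
    - (2%:R * A) * (h2 * h2) by rewrite /Q /h0 /h1 /h2; ring.
  by do ?apply: dvdp_sub; apply: dvdp_mull => //; apply: PPhh.
have gram1 : P ^+ 2 %| f1 ^+ 2 * D.
  have -> : f1 ^+ 2 * D = (2%:R * A ^+ 2) * Q - 3%:R * (h2 * h2)
    - (2%:R * A ^+ 2) * (h0 * h0) + (4%:R * A) * (h0 * h2).
    by rewrite /Q /h0 /h1 /h2; ring.
  by apply: dvdp_add; do ?apply: dvdp_sub; apply: dvdp_mull => //; apply: PPhh.
have gram2 : P ^+ 2 %| f2 ^+ 2 * D.
  have -> : f2 ^+ 2 * D = (6%:R * A) * Q - 3%:R * (h1 * h1)
    - (2%:R * A) * (h0 * h0) by rewrite /Q /h0 /h1 /h2; ring.
  by do ?apply: dvdp_sub; apply: dvdp_mull => //; apply: PPhh.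
have [|nPD] := boolP (P ^+ 2 %| D); [by left | right].
have dvd_coord f : P ^+ 2 %| f ^+ 2 * D -> P %| f.
  move=> Pf; apply: contraNT nPD => nPf; move: Pf; rewrite Gauss_dvdpr //.
  by rewrite coprimep_expl // coprimep_expr // irreducible_poly_coprime.
by split; apply: dvd_coord.
Qed.

(** When the cubic is Eisenstein at P, A y^j / P and B y^j / P are integral;
    multiplying by y^2, then by y, and subtracting what is integral isolates
    (f_i / P) y^2, whose norm f_i^3 B^2 / P^3 has B / P prime to P. *)
Lemma eisenstein_dvd : P %| A -> P %| B -> ~~ (P ^+ 2 %| B) ->
  [/\ P %| f0, P %| f1 & P %| f2].
Proof.
case/dvdpP=> alpha eA; case/dvdpP=> beta eB; rewrite eB expr2.
have P0p := irredp_neq0 irrP.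
rewrite dvdp_mul2r // => nPb.
have top f : integralOver embL (comb 0 0 (coord f)) -> P %| f.
  move/int_norm=> Nf; have : P %| beta ^+ 2 * f ^+ 3.
    apply: (dvdp_is_poly emb_inj P0p); move: Nf; congr (is_poly _ _).
    by rewrite /cubic_norm eB; field.
  by case/(irreducible_dvdM irrP)/orP=> /(irreducible_dvdX irrP)//;
    rewrite (negPf nPb).
have bE (f : {poly K}) : emb B * coord f = emb (beta * f).
  by rewrite eB; field.
have aE (f : {poly K}) : emb A * coord f = emb (alpha * f).
  by rewrite eA; field.
have Pf0 : P %| f0.
  apply: top.
  have -> : comb 0 0 (coord f0) =
      comb (coord f0) (coord f1) (coord f2) * (y * y)
      - comb (emb (- (beta * f1))) (emb (alpha * f1 - beta * f2))
         (emb (alpha * f2)).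
    by rewrite rmorphN rmorphB -!bE -!aE /quadratic; ring: y_cubic.
  apply: integral_sub (in_order_integral _ _ _).
  exact: integral_mul int_z (integral_mul int_y int_y).
have [g0 e0] := dvdpP _ _ Pf0.
have c0 : coord f0 = emb g0 by rewrite e0; field.
have Pf1 : P %| f1.
  apply: top.
  have -> : comb 0 0 (coord f1) =
      (comb (coord f0) (coord f1) (coord f2)
        - comb (emb g0) (emb 0) (emb 0)) * y
      - comb (emb (- (beta * f2))) (emb (alpha * f2)) (emb 0).
    by rewrite rmorphN c0 rmorph0 -bE -aE /quadratic; ring: y_cubic.
  apply: integral_sub (in_order_integral _ _ _).
  exact: integral_mul (integral_sub int_z (in_order_integral _ _ _)) int_y.
have [g1 e1] := dvdpP _ _ Pf1.
have c1 : coord f1 = emb g1 by rewrite e1; field.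
split=> //; apply: top.
have -> : comb 0 0 (coord f2) =
    comb (coord f0) (coord f1) (coord f2) - comb (emb g0) (emb g1) (emb 0).
  by rewrite c0 c1 rmorph0 /quadratic; ring.
exact: integral_sub int_z (in_order_integral _ _ _).
Qed.

End Denominator.

Variables D1 D2 : {poly K}.
Hypothesis sqf : squarefree_factorization D D1 D2.
Hypothesis D2B : D2 %| B.

Lemma irreducible_denominator P f0 f1 f2 : irreducible_poly P ->
    integralOver embL
      (comb (emb f0 / emb P) (emb f1 / emb P) (emb f2 / emb P)) ->
  [/\ P %| f0, P %| f1 & P %| f2].
Proof.
move=> irrP int_z; case: (index_square_dvd_disc irrP int_z) => // P2D.
have PD2 := dvd_square_part irrP sqf P2D.
have [PA nP2B] := square_part_eisenstein two0 irrP erefl sqf D2B PD2.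
exact: eisenstein_dvd (dvdp_trans PD2 D2B) nP2B.
Qed.

End MaximalOrder.

Section FiniteConstants.
Variables (K : finFieldType) (F : fieldType) (emb : {rmorphism {poly K} -> F}).
Hypothesis emb_inj : injective emb.
Hypothesis emb_frac : forall u : F, exists n d, d != 0 /\ u = emb n / emb d.
Hypothesis two0 : 2%:R != 0 :> K.
Variables (L : fieldExtType F) (A B : {poly K}) (y : L).
Hypothesis irr_cubic :
  irreducible_poly ('X^3 - (emb A)%:P * 'X + (emb B)%:P : {poly F}).
Hypothesis gen_y : (<<1; y>> = fullv)%VS.
Hypothesis y_cubic : y ^+ 3 = in_alg L (emb A) * y - in_alg L (emb B).
Variables D1 D2 : {poly K}.
Hypothesis sqf :
  squarefree_factorization (4%:R * A ^+ 3 - 27%:R * B ^+ 2) D1 D2.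
Hypothesis D2B : D2 %| B.
Local Notation embL := (in_alg L \o emb).

(** A denominator loses one irreducible factor at a time. *)
Lemma integral_in_order (z : L) : integralOver embL z -> in_order emb y z.
Proof.
move=> int_z.
have [v v0 Ovz] := common_denominator emb_inj emb_frac gen_y y_cubic z.
have [n] := ubnP (size v); elim: n v v0 Ovz => // n IHn v v0 Ovz le_vn.
have [sv | sv] := leqP (size v) 1.
  have /size_poly1P[c c0 vE] : size v == 1%N.
    by rewrite eqn_leq sv size_poly_gt0.
  have -> : z = embL (c^-1)%:P * (embL v * z).
    rewrite mulrA -[LHS]mul1r; congr (_ * _).
    transitivity (embL ((c^-1)%:P * c%:P)); last by rewrite rmorphM vE.
    by rewrite -polyCM mulVf // embL1.
  have := in_orderM y_cubic (in_order_emb emb y (c^-1)%:P) Ovz; exact.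
have [P irrP /dvdpP[w vE]] := irreducible_factor sv.
have P0 := irredp_neq0 irrP.
have w0 : w != 0 by apply: contraNneq v0 => e; rewrite vE e mul0r.
have [f0 [f1 [f2 e]]] := Ovz.
have P0F : emb P != 0 by rewrite emb_eq0.
have ewz : embL w * z =
    quadratic (in_alg L) y (emb f0 / emb P) (emb f1 / emb P) (emb f2 / emb P).
  have -> : embL w * z = in_alg L (emb P)^-1 * (embL v * z).
    have invP : in_alg L (emb P)^-1 * in_alg L (emb P) = 1.
      by rewrite -rmorphM mulVf // rmorph1.
    have -> : embL v = embL w * in_alg L (emb P) by rewrite vE rmorphM.
    by rewrite -[LHS]mul1r -invP; ring.
  by rewrite e combZ; congr quadratic; rewrite mulrC.
have int_wz : integralOver embL (embL w * z).
  exact: integral_mul (integral_id _ _) int_z.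
rewrite ewz in int_wz.
have [] := irreducible_denominator emb_inj emb_frac two0 irr_cubic gen_y
  y_cubic sqf D2B irrP int_wz.
move=> /dvdpP[g0 e0] /dvdpP[g1 e1] /dvdpP[g2 e2].
apply: (IHn w) => //.
  by exists g0, g1, g2; rewrite ewz e0 e1 e2 !rmorphM !mulfK.
have sP : (1 < size P)%N := irrP.1.
by move: le_vn sP; rewrite vE size_mul //; move: (size w) (size P) => *; lia.
Qed.

End FiniteConstants.

(** * Degrees and leading coefficients *)

Section PolySize.
Variable R : idomainType.
Implicit Types f g h : {poly R}.

Lemma coef_top_mul f g n m : (size f <= n.+1)%N -> (size g <= m.+1)%N ->
  (f * g)`_(n + m) = f`_n * g`_m.
Proof.
move=> sf sg; have lt_n : (n < (n + m).+1)%N by rewrite ltnS leq_addr.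
rewrite coefM (bigD1 (Ordinal lt_n)) //= big1 ?addr0; first by rewrite addKn.
move=> i; rewrite -val_eqE /= => ni; have [lt_in | le_ni] := ltnP i n.
  by rewrite [g`_ _]nth_default ?mulr0 // (leq_trans sg) // ltn_subRL ltn_add2r.
by rewrite [f`_ _]nth_default ?mul0r // (leq_trans sf) // ltn_neqAle eq_sym ni.
Qed.

Lemma size_leq_drop f n : (size f <= n.+1)%N -> f`_n = 0 -> (size f <= n)%N.
Proof.
rewrite leq_eqVlt ltnS => /orP[/eqP sf fn0|//].
have : lead_coef f = 0 by rewrite lead_coefE sf.
by move/eqP; rewrite lead_coef_eq0 => /eqP->; rewrite size_poly0.
Qed.

Lemma size_mul_small f g h : (size g < size h)%N -> f != 0 ->
  (size (g * f)%R < size (h * f)%R)%N.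
Proof.
move=> lt_gh f0.
have h0 : h != 0 by rewrite -size_poly_gt0 (leq_ltn_trans _ lt_gh).
rewrite (size_mul h0 f0); apply: leq_ltn_trans (size_polyMleq g f) _.
move: lt_gh f0; rewrite -(size_poly_gt0 f).
by move: (size f) (size g) (size h) => x y z *; lia.
Qed.

Lemma size_mul_le f g h n : (size g <= size h)%N -> h != 0 ->
  (size (h * f)%R <= n)%N -> (size (g * f)%R <= n)%N.
Proof.
have [->|f0] := eqVneq f 0; first by rewrite !mulr0.
move=> le_gh h0; rewrite size_mul //; apply: leq_trans.
apply: leq_trans (size_polyMleq g f) _.
by move: le_gh; move: (size f) (size g) (size h) => x y z *; lia.
Qed.

Lemma coef_small f g h n : (size g < size h)%N ->
  (size (h * f)%R <= n.+1)%N -> (g * f)`_n = 0.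
Proof.
have [->|f0] := eqVneq f 0; first by rewrite !mulr0 coef0.
move=> lt_gh le_n; have := size_mul_small lt_gh f0 => {}lt_gh.
by rewrite nth_default // -ltnS (leq_trans lt_gh).
Qed.

Lemma sizeD_le f g n :
  (size f <= n)%N -> (size g <= n)%N -> (size (f + g)%R <= n)%N.
Proof. by move=> sf sg; rewrite (leq_trans (size_polyD _ _)) // geq_max sf. Qed.

Lemma sizeB_le f g n :
  (size f <= n)%N -> (size g <= n)%N -> (size (f - g)%R <= n)%N.
Proof. by move=> sf sg; rewrite sizeD_le ?size_polyN. Qed.

Lemma sizeM_le f g n m : (size f <= n.+1)%N -> (size g <= m.+1)%N ->
  (size (f * g)%R <= (n + m).+1)%N.
Proof.
move=> sf sg; apply: leq_trans (size_polyMleq f g) _.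
by move: sf sg; move: (size f) (size g) => x y *; lia.
Qed.

End PolySize.

(** * The residue ring at infinity *)

(** The form is Y^2 + 3 Y Z + 3 Z^2 = Z^2 (w^2 + w + 1) with w = Y / Z + 1, so
    a nontrivial zero is a primitive cube root of unity; but x -> x^3 is
    injective on a field with q = 2 mod 3. *)
Lemma card_mod3_anisotropic (K : finFieldType) (Y Z : K) :
    3%:R != 0 :> K -> (#|K| %% 3)%N = 2 ->
    Y ^+ 2 + 3%:R * Y * Z + 3%:R * Z ^+ 2 = 0 ->
  Y = 0 /\ Z = 0.
Proof.
move=> three0 card3 YZ.
have [Z0|Z0] := eqVneq Z 0.
  move: YZ; rewrite Z0 mulr0 expr0n mulr0 !addr0 => /eqP.
  by rewrite expf_eq0 /= => /eqP.
pose w := Y / Z + 1.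
have w_root : w ^+ 2 + w + 1 = 0.
  transitivity ((Y ^+ 2 + 3%:R * Y * Z + 3%:R * Z ^+ 2) / Z ^+ 2).
    by rewrite /w; field.
  by rewrite YZ mul0r.
have w3 : w ^+ 3 = 1.
  by apply/eqP; rewrite -subr_eq0 -(mulr0 (w - 1)) -w_root; apply/eqP; ring.
have ww : w ^+ 2 = w.
  rewrite -[RHS]expf_card (divn_eq #|K| 3) card3 exprD mulnC exprM w3.
  by rewrite expr1n mul1r.
have w0 : w != 0.
  by apply: contra_eq_neq w3 => ->; rewrite expr0n eq_sym oner_eq0.
have w1 : w = 1 by apply: (mulfI w0); rewrite mulr1 -expr2.
by case/eqP: three0; rewrite -w_root w1; ring.
Qed.

Section Residues.
Variable K : fieldType.
Hypothesis anisotropic :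
  forall Y Z : K, Y ^+ 2 + 3%:R * Y * Z + 3%:R * Z ^+ 2 = 0 -> Y = 0 /\ Z = 0.

(** In K[T] / (T^3 - 3 T^2 + 3 T) the hypotheses say that the product of
    Y T + Z T^2 and X' + Y' T + Z' T^2 is 0. Since T is invertible modulo
    T^2 - 3 T + 3, which is irreducible, the second factor is a multiple of
    T^2 - 3 T + 3. The two linear equations in X' - 3 Z' and Y' + 3 Z' have
    determinant Y^2 + 3 Y Z + 3 Z^2. *)
Lemma residue_annihilator (Y Z X' Y' Z' : K) : (Y, Z) != (0, 0) ->
    Y * X' - 3%:R * (Y * Z' + Z * Y') - 9%:R * (Z * Z') = 0 ->
    Y * Y' + Z * X' + 3%:R * (Y * Z' + Z * Y') + 6%:R * (Z * Z') = 0 ->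
  X' = 3%:R * Z' /\ Y' = - 3%:R * Z'.
Proof.
move=> YZ0 e1 e2; set d := Y ^+ 2 + 3%:R * Y * Z + 3%:R * Z ^+ 2.
have d0 : d != 0.
  by apply: contraNneq YZ0 => /anisotropic[-> ->].
have eX : d * (X' - 3%:R * Z') = 0.
  transitivity ((Y + 3%:R * Z) * 0 + 3%:R * Z * 0); last by ring.
  by rewrite -{1}e1 -e2 /d; ring.
have eY : d * (Y' + 3%:R * Z') = 0.
  transitivity (Y * 0 - Z * 0); last by ring.
  by rewrite -{1}e2 -e1 /d; ring.
move/eqP: eX; rewrite mulf_eq0 (negPf d0) /= subr_eq0 => /eqP->.
by move/eqP: eY; rewrite mulf_eq0 (negPf d0) /= addr_eq0 mulNr => /eqP->.
Qed.

End Residues.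

(** * Descent on units *)

Section UnitDescent.
Variables (K L : fieldType) (phi : {rmorphism {poly K} -> L}).
Variables (A a : {poly K}) (kappa : K) (e : L).
Hypothesis size_a : (1 < size a)%N.
Hypothesis size_A : (size A < size (a ^+ 2)%R)%N.
Hypothesis kappa0 : kappa != 0.
Hypothesis three0 : 3%:R != 0 :> K.
Hypothesis anisotropic :
  forall Y Z : K, Y ^+ 2 + 3%:R * Y * Z + 3%:R * Z ^+ 2 = 0 -> Y = 0 /\ Z = 0.
Hypothesis free_e : forall r s t : {poly K},
  quadratic phi e r s t = 0 -> [/\ r = 0, s = 0 & t = 0].
Hypothesis e_cubic : e ^+ 3 =
  phi (3%:R * a) * e ^+ 2 - phi (3%:R * a ^+ 2 - A) * e - phi kappa%:P.

Let m := (size a).-1.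
Let a0 : a != 0. Proof. by rewrite -size_poly_gt0 ltnW. Qed.
Let size_aE : size a = m.+1. Proof. by rewrite prednK // ltnW. Qed.
Let m_gt0 : (0 < m)%N. Proof. by rewrite -ltnS -size_aE. Qed.

Let size_one_aX k : (0 < k)%N -> (size (1%:P : {poly K}) < size (a ^+ k)%R)%N.
Proof.
move=> k0; rewrite size_polyC oner_eq0 -[size (a ^+ k)]prednK; last first.
  by rewrite size_poly_gt0 expf_neq0.
by rewrite size_exp ltnS muln_gt0 m_gt0.
Qed.

Local Notation elt := (quadratic phi e).

Lemma unit_coord_eqs r s t r' s' t' : elt r s t * elt r' s' t' = 1 ->
  [/\ r * r' - kappa%:P * (s * t' + t * s' + 3%:R * a * (t * t')) = 1,
      r * s' + s * r' - (3%:R * a ^+ 2 - A) * (s * t' + t * s')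
        - (9%:R * a ^+ 3 - 3%:R * a * A + kappa%:P) * (t * t') = 0
    & r * t' + s * s' + t * r' + 3%:R * a * (s * t' + t * s')
        + (6%:R * a ^+ 2 + A) * (t * t') = 0].
Proof.
set f0 := (X in [/\ X = 1, _ & _]); set f1 := (X in [/\ _, X = 0 & _]).
set f2 := (X in [/\ _, _ & X = 0]) => zz'.
have [] // := free_e (r := f0 - 1) (s := f1) (t := f2).
  transitivity (elt r s t * elt r' s' t' - 1); last by rewrite zz' subrr.
  by rewrite /quadratic /f0 /f1 /f2; ring: e_cubic.
by move/subr0_eq.
Qed.

Let size_kappa k : (0 < k)%N -> (size kappa%:P < size (a ^+ k)%R)%N.
Proof.
move=> k0; apply: leq_ltn_trans (size_one_aX k0).
by rewrite !size_polyC kappa0 oner_eq0.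
Qed.

Let coefMnat k (f : {poly K}) n : (k%:R * f)`_n = k%:R * f`_n.
Proof. by rewrite !mulr_natl coefMn. Qed.

Let size_mul3_le (f : {poly K}) n :
  (size f <= n)%N -> (size (3%:R * f)%R <= n)%N.
Proof.
by move=> sf; rewrite mulr_natl -scaler_nat (leq_trans (size_scale_leq _ _)).
Qed.

(** A bound n on the pole orders of z at the infinite places. The factors a and
    a^2 account for the pole orders m and 2 m of e and e^2. *)
Definition bounded n (z : L) := exists r s t,
  [/\ z = elt r s t, (size r <= n.+1)%N, (size (a * s)%R <= n.+1)%N
    & (size (a ^+ 2 * t)%R <= n.+1)%N].

Let size_mul_a f : f != 0 -> size (a * f) = (m + size f)%N.
Proof. by move=> f0; rewrite size_mul // size_aE. Qed.

Let size_div_a n (f : {poly K}) : (m <= n)%N -> (size (a * f)%R <= n.+1)%N ->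
  (size f <= (n - m).+1)%N.
Proof.
have [->|f0] := eqVneq f 0; first by rewrite size_poly0.
by rewrite size_mul_a //; move: (size f) => sf; clear; lia.
Qed.

Let size_mul_a_le n (f : {poly K}) : (size f <= n)%N ->
  (size (a * f)%R <= n + m)%N.
Proof.
have [->|f0] := eqVneq f 0; first by rewrite mulr0 size_poly0.
by rewrite size_mul_a // [(n + m)%N]addnC leq_add2l.
Qed.

Lemma e_neq0 : e != 0.
Proof.
apply/eqP=> e0; have [] := free_e (r := 0) (s := 1) (t := 0).
  by rewrite /quadratic e0; ring.
by move=> _ /eqP; rewrite oner_eq0.
Qed.

Section Step.
Variables (n n' : nat) (r s t r' s' t' : {poly K}).
Hypothesis sr : (size r <= n.+1)%N.
Hypothesis ss : (size (a * s)%R <= n.+1)%N.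
Hypothesis st : (size (a ^+ 2 * t)%R <= n.+1)%N.
Hypothesis sr' : (size r' <= n'.+1)%N.
Hypothesis ss' : (size (a * s')%R <= n'.+1)%N.
Hypothesis st' : (size (a ^+ 2 * t')%R <= n'.+1)%N.
Hypothesis zz' : elt r s t * elt r' s' t' = 1.
Local Notation c3 := (s * t' + t * s').
Local Notation c4 := (t * t').
Local Notation X := (r`_n).
Local Notation Y := ((a * s)`_n).
Local Notation Z := ((a ^+ 2 * t)`_n).
Local Notation X' := (r'`_n').
Local Notation Y' := ((a * s')`_n').
Local Notation Z' := ((a ^+ 2 * t')`_n').

Let sc3 : (size (a ^+ 3 * c3)%R <= (n + n').+1)%N.
Proof.
have -> : a ^+ 3 * c3 = (a * s) * (a ^+ 2 * t') + (a ^+ 2 * t) * (a * s').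
  by ring.
by rewrite sizeD_le ?sizeM_le.
Qed.

Let sc4 : (size (a ^+ 4 * c4)%R <= (n + n').+1)%N.
Proof.
have -> : a ^+ 4 * c4 = (a ^+ 2 * t) * (a ^+ 2 * t') by ring.
by rewrite sizeM_le.
Qed.

(** For j = 0, 1, 2, multiplying the j-th coordinate equation by a^j makes it
    homogeneous of degree n + n'; the terms with A or kappa in place of a power
    of a are of smaller degree. *)
Lemma leading_eqs : (0 < n + n')%N ->
  [/\ X * X' = 0,
      X * Y' + Y * X' - 3%:R * (Y * Z' + Z * Y') - 9%:R * (Z * Z') = 0
    & X * Z' + Y * Y' + Z * X' + 3%:R * (Y * Z' + Z * Y')
      + 6%:R * (Z * Z') = 0].
Proof.
move=> N0; have [e1 e2 e3] := unit_coord_eqs zz'; have top := coef_top_mul.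
have k_c3 : (kappa%:P * c3)`_(n + n') = 0.
  by apply: coef_small sc3; apply: size_kappa.
have k_c4 : (kappa%:P * (a * c4))`_(n + n') = 0.
  apply: (@coef_small _ _ _ (a ^+ 3)); first exact: size_kappa.
  by have -> : a ^+ 3 * (a * c4) = a ^+ 4 * c4 by ring.
have A_c3 : (A * (a * c3))`_(n + n') = 0.
  apply: (coef_small size_A).
  by have -> : a ^+ 2 * (a * c3) = a ^+ 3 * c3 by ring.
have A_c4 : (A * (a ^+ 2 * c4))`_(n + n') = 0.
  apply: (coef_small size_A).
  by have -> : a ^+ 2 * (a ^+ 2 * c4) = a ^+ 4 * c4 by ring.
split.
- have := congr1 (fun p : {poly K} => p`_(n + n')) e1.
  have -> : r * r' - kappa%:P * (c3 + 3%:R * a * c4)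
    = r * r' - kappa%:P * c3 - 3%:R * (kappa%:P * (a * c4)) by ring.
  rewrite !coefB coefMnat k_c3 k_c4 mulr0 !subr0 top // coef1.
  by rewrite eqn0Ngt N0.
- have := congr1 (fun p : {poly K} => (a * p)`_(n + n')) e2.
  rewrite (_ : a * _ = r * (a * s') + (a * s) * r'
     - 3%:R * ((a * s) * (a ^+ 2 * t') + (a ^+ 2 * t) * (a * s'))
     - 9%:R * ((a ^+ 2 * t) * (a ^+ 2 * t'))
     + A * (a * c3) + 3%:R * (A * (a ^+ 2 * c4)) - kappa%:P * (a * c4));
    last by ring.
  rewrite mulr0 coef0 => E; rewrite -[RHS]E.
  by rewrite !(coefB, coefD) !coefMnat coefD A_c3 k_c4 A_c4 !top //; ring.
have := congr1 (fun p : {poly K} => (a ^+ 2 * p)`_(n + n')) e3.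
rewrite (_ : a ^+ 2 * _ = r * (a ^+ 2 * t') + (a * s) * (a * s')
   + (a ^+ 2 * t) * r'
   + 3%:R * ((a * s) * (a ^+ 2 * t') + (a ^+ 2 * t) * (a * s'))
   + 6%:R * ((a ^+ 2 * t) * (a ^+ 2 * t')) + A * (a ^+ 2 * c4));
  last by ring.
rewrite mulr0 coef0 => E; rewrite -[RHS]E.
by rewrite !coefD !coefMnat coefD A_c4 !top //; ring.
Qed.

(** The constant coordinate of z z' = 1 is r r' = 1 + kappa c with
    deg c <= n + n' - 3 m, and r' has degree exactly n'. *)
Lemma constant_coord_small :
  (0 < n')%N -> X' != 0 -> (size (a ^+ 3 * r)%R <= n.+1)%N.
Proof.
move=> n'0 X'0; have [e1 _ _] := unit_coord_eqs zz'.
have [->|r0] := eqVneq r 0; first by rewrite mulr0 size_poly0.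
have r'E : size r' = n'.+1.
  apply/eqP; rewrite eqn_leq sr' /= ltnNge; apply: contra X'0 => sr'n.
  by rewrite nth_default.
have r'0 : r' != 0 by rewrite -size_poly_gt0 r'E.
set c := c3 + 3%:R * a * c4 in e1.
have sc : (size (a ^+ 3 * c)%R <= (n + n').+1)%N.
  have -> : a ^+ 3 * c = a ^+ 3 * c3 + 3%:R * (a ^+ 4 * c4) by rewrite /c; ring.
  by rewrite sizeD_le ?size_mul3_le.
have c0 : c != 0.
  apply/eqP=> c0; have rr1 : r * r' = 1 by move: e1; rewrite c0 mulr0 subr0.
  have := size_mul r0 r'0; rewrite rr1 size_poly1 r'E.
  by move: r0; rewrite -size_poly_gt0; move: (size r) n'0 => x; clear; lia.
have srr : (size (r * r')%R <= size c)%N.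
  have -> : r * r' = kappa%:P * c + 1 by rewrite -e1; ring.
  rewrite sizeD_le //; last by rewrite size_poly1 size_poly_gt0.
  by rewrite mul_polyC size_scale.
move: srr sc; rewrite (size_mul r0 r'0) r'E.
rewrite !(size_mul (expf_neq0 3 a0)) //.
have : (0 < size (a ^+ 3))%N by rewrite size_poly_gt0 expf_neq0.
by move: (size r) (size c) (size (a ^+ 3)) n'0 => x y w; clear; lia.
Qed.

(** X = 0 says that the leading part of z is a multiple of T, so that of z' is a
    multiple of T^2 - 3 T + 3. The latter makes X' nonzero, hence r so small
    that dividing by e lowers the bound of z by m; it is also killed by T, so
    multiplying by e raises the bound of z' by less than m. *)
Lemma unit_div_mul_bounds : (0 < n)%N -> (0 < n')%N ->
    X = 0 -> (Y, Z) != (0, 0) -> (X', Y', Z') != (0, 0, 0) ->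
  [/\ (m <= n)%N, bounded (n - m) (elt r s t / e)
    & bounded (n' + m).-1 (elt r' s' t' * e)].
Proof.
move=> n0 n'0 X0 YZ0 XYZ'0.
have [_ e2 e3] := leading_eqs (ltn_addr n' n0).
rewrite X0 !mul0r !add0r in e2 e3.
have [eX eY] := residue_annihilator anisotropic YZ0 e2 e3.
have Z'0 : Z' != 0.
  by apply: contraNneq XYZ'0 => Z'0; rewrite eX eY Z'0 !mulr0.
have X'0 : X' != 0 by rewrite eX mulf_neq0.
have sr3 := constant_coord_small n'0 X'0.
have le_mn : (m <= n)%N.
  move: YZ0; rewrite xpair_eqE negb_and => /orP[Y0|Z0].
    have s0 : s != 0.
      by apply: contraNneq Y0 => ->; rewrite mulr0 coef0.
    move: ss; rewrite size_mul_a //; move: s0; rewrite -size_poly_gt0.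
    by move: (size s) => x; clear; lia.
  have t0 : t != 0.
    by apply: contraNneq Z0 => ->; rewrite mulr0 coef0.
  move: st; rewrite expr2 -mulrA size_mul_a ?mulf_neq0 //.
  have : (0 < size (a * t)%R)%N by rewrite size_poly_gt0 mulf_neq0.
  by move: (size _) => x; clear; lia.
pose k := (kappa^-1)%:P.
have kK : phi k * phi kappa%:P = 1.
  by rewrite -rmorphM -polyCM mulVf // polyC1 rmorph1.
have size_k (f : {poly K}) : size (k * f) = size f.
  by rewrite mul_polyC size_scale // invr_eq0.
split=> //.
(* e^-1 = - kappa^-1 (e^2 - 3 a e + 3 a^2 - A) *)
- exists (s - k * ((3%:R * a ^+ 2 - A) * r)),
    (t + 3%:R * (k * (a * r))), (- (k * r)).
  split.
  + apply: (mulIf e_neq0); rewrite divfK ?e_neq0 // /quadratic.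
    by ring: e_cubic kK.
  + apply: size_div_a => //.
    rewrite (_ : a * _ = a * s - k * (3%:R * (a ^+ 3 * r) - A * (a * r)));
      last by ring.
    rewrite sizeB_le // size_k sizeB_le ?size_mul3_le //.
    apply: size_mul_le (ltnW size_A) _ _; first exact: expf_neq0.
    by have -> : a ^+ 2 * (a * r) = a ^+ 3 * r by ring.
  + apply: size_div_a => //.
    have -> : a * (a * (t + 3%:R * (k * (a * r)))) =
      a ^+ 2 * t + 3%:R * (k * (a ^+ 3 * r)) by ring.
    by rewrite sizeD_le ?size_mul3_le ?size_k.
  apply: size_div_a => //.
  have -> : a * (a ^+ 2 * - (k * r)) = - (k * (a ^+ 3 * r)) by ring.
  by rewrite size_polyN size_k.
have up : ((n' + m).-1.+1 = n' + m)%N by rewrite prednK // addn_gt0 n'0.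
exists (- (kappa%:P * t')), (r' - (3%:R * a ^+ 2 - A) * t'),
  (s' + 3%:R * a * t').
split; rewrite ?up.
- by rewrite /quadratic; ring: e_cubic.
- rewrite size_polyN mul_polyC size_scale //.
  rewrite -[t']mul1r.
  apply: (@leq_trans n'.+1); last by rewrite -addn1 leq_add2l.
  apply: size_mul_le _ _ st'; last exact: expf_neq0.
  by rewrite size_poly1 size_poly_gt0 expf_neq0.
- apply: size_mul_a_le; apply: size_leq_drop.
    rewrite (_ : _ - _ = r' - 3%:R * (a ^+ 2 * t') + A * t'); last by ring.
    rewrite sizeD_le ?sizeB_le ?size_mul3_le //.
    by apply: size_mul_le (ltnW size_A) _ st'; apply: expf_neq0.
  rewrite (_ : _ - _ = r' - 3%:R * (a ^+ 2 * t') + A * t'); last by ring.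
  by rewrite coefD coefB coefMnat eX subrr add0r (coef_small size_A).
rewrite (_ : a ^+ 2 * _ = a * (a * s' + 3%:R * (a ^+ 2 * t'))); last by ring.
apply: size_mul_a_le; apply: size_leq_drop.
  by rewrite sizeD_le ?size_mul3_le.
by rewrite coefD coefMnat eY; ring.
Qed.

End Step.

Lemma bounded_elt r s t : exists n, bounded n (elt r s t).
Proof.
exists (size r + size (a * s)%R + size (a ^+ 2 * t)%R)%N, r, s, t.
split; first [by [] | apply: leqW].
- by rewrite -addnA leq_addr.
- by rewrite addnAC leq_addl.
- by rewrite leq_addl.
Qed.

(** As deg a > 0, bound 0 leaves room for a constant only. *)
Lemma bounded0_const z : z != 0 -> bounded 0 z ->
  exists2 c : K, c != 0 & z = phi c%:P.
Proof.
move=> z0 [r [s [t [zE sr ss st]]]].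
have small (f : {poly K}) j :
    (0 < j)%N -> (size (a ^+ j * f)%R <= 1)%N -> f = 0.
  move=> j0; apply: contraTeq => f0; rewrite -ltnNge.
  apply: leq_trans (size_mul_small (size_one_aX j0) f0).
  by rewrite mul1r ltnS size_poly_gt0.
have s0 : s = 0 by apply: (small s 1%N).
have t0 : t = 0 by apply: (small t 2%N).
move: zE; rewrite (size1_polyC sr) s0 t0 /quadratic !rmorph0 !mul0r !addr0.
move=> zE.
by exists r`_0 => //; apply: contraNneq z0 => c0; rewrite zE c0 polyC0 rmorph0.
Qed.

Lemma bounded_pred n (r s t : {poly K}) :
    (size r <= n.+2)%N -> (size (a * s)%R <= n.+2)%N ->
    (size (a ^+ 2 * t)%R <= n.+2)%N ->
    (r`_n.+1, (a * s)`_n.+1, (a ^+ 2 * t)`_n.+1) = (0, 0, 0) ->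
  bounded n (elt r s t).
Proof.
move=> sr ss st [r0 s0 t0]; exists r, s, t.
by split; [reflexivity | exact: size_leq_drop sr r0 | exact: size_leq_drop ss s0
  | exact: size_leq_drop st t0].
Qed.

(** Induction on the sum of the two bounds: either a leading part vanishes and
    its bound drops, or z is divided by e or multiplied by e according to the
    factor of the residue ring in which its leading part vanishes. *)
Lemma unit_power n n' z z' : bounded n z -> bounded n' z' -> z * z' = 1 ->
  exists2 c : K, c != 0 & exists k : int, z = phi c%:P * e ^ k.
Proof.
have [N] := ubnP (n + n'); elim: N n n' z z' => // N IHN n n' z z' le_N.
have e0 := e_neq0.
move=> bz bz' zz'.
have z0 : z != 0.
  by apply: contra_eq_neq zz' => ->; rewrite mul0r eq_sym oner_eq0.
have z'0 : z' != 0.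
  by apply: contra_eq_neq zz' => ->; rewrite mulr0 eq_sym oner_eq0.
case: n bz le_N => [|n] bz le_N.
  have [c c0 ->] := bounded0_const z0 bz.
  by exists c => //; exists 0; rewrite expr0z mulr1.
case: n' bz' le_N => [|n'] bz' le_N.
  have [c c0 z'E] := bounded0_const z'0 bz'.
  exists c^-1; first by rewrite invr_eq0.
  exists 0; rewrite expr0z mulr1; apply: (mulIf z'0).
  by rewrite zz' z'E -rmorphM -polyCM mulVf // polyC1 rmorph1.
have [r [s [t [zE sr ss st]]]] := bz.
have [r' [s' [t' [z'E sr' ss' st']]]] := bz'.
have [lead0|lead0] :=
    eqVneq (r`_n.+1, (a * s)`_n.+1, (a ^+ 2 * t)`_n.+1) (0, 0, 0).
  by apply: (IHN n n'.+1 z z') => //; rewrite zE; apply: bounded_pred.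
have [lead'0|lead'0] :=
    eqVneq (r'`_n'.+1, (a * s')`_n'.+1, (a ^+ 2 * t')`_n'.+1) (0, 0, 0).
  apply: (IHN n.+1 n' z z') => //; last by rewrite z'E; apply: bounded_pred.
  by rewrite -ltnS -addnS.
have zz'E : elt r s t * elt r' s' t' = 1 by rewrite -zE -z'E.
have z'zE : elt r' s' t' * elt r s t = 1 by rewrite mulrC.
have [XX' _ _] := leading_eqs sr ss st sr' ss' st' zz'E isT.
have [X0|X0] := eqVneq r`_n.+1 0.
  have [|le_mn bze bz'e] :=
    unit_div_mul_bounds sr ss st sr' ss' st' zz'E isT isT X0 _ lead'0.
    by move: lead0; rewrite !xpair_eqE X0 eqxx.
  rewrite -zE -z'E in bze bz'e.
  have [||c c0 [k zeE]] := IHN _ _ _ _ _ bze bz'e.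
  + by move: le_N le_mn m_gt0; clear; lia.
  + by rewrite mulrACA [e^-1 * _]mulrC mulfV // mulr1.
  exists c => //; exists (k + 1).
  by rewrite expfzDr // mulrA -zeE expr1z divfK.
have X'0 : r'`_n'.+1 = 0.
  by move/eqP: XX'; rewrite mulf_eq0 (negPf X0) => /eqP.
have [|le_mn bz'e bze] :=
  unit_div_mul_bounds sr' ss' st' sr ss st z'zE isT isT X'0 _ lead0.
  by move: lead'0; rewrite !xpair_eqE X'0 eqxx.
rewrite -zE -z'E in bze bz'e.
have [||c c0 [k zeE]] := IHN _ _ _ _ _ bze bz'e.
+ by move: le_N le_mn m_gt0; clear; lia.
+ by rewrite mulrACA mulfV // mulr1.
exists c => //; exists (k - 1).
by rewrite expfzDr // mulrA -zeE exprN1 mulfK.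
Qed.

End UnitDescent.

(** * Change of generator *)

Section Shift.
Variables (K F : fieldType) (emb : {rmorphism {poly K} -> F}).
Hypothesis emb_inj : injective emb.
Variables (L : fieldExtType F) (A B : {poly K}) (y : L).
Hypothesis irr_cubic :
  irreducible_poly ('X^3 - (emb A)%:P * 'X + (emb B)%:P : {poly F}).
Hypothesis y_cubic : y ^+ 3 = in_alg L (emb A) * y - in_alg L (emb B).
Variables (phi : {rmorphism {poly K} -> L}) (a : {poly K}).
Hypothesis phiE : forall f, phi f = in_alg L (emb f).

Lemma comb_shift r s t :
  quadratic (in_alg L) y (emb r) (emb s) (emb t) =
  quadratic phi (phi a + y) (r - s * a + t * a ^+ 2) (s - 2%:R * t * a) t.
Proof. by rewrite /quadratic -!phiE; ring. Qed.

Lemma free_shift r s t : quadratic phi (phi a + y) r s t = 0 ->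
  [/\ r = 0, s = 0 & t = 0].
Proof.
have -> : quadratic phi (phi a + y) r s t =
  quadratic (in_alg L) y (emb (r + s * a + t * a ^+ 2))
    (emb (s + 2%:R * t * a)) (emb t).
  by rewrite /quadratic -!phiE; ring.
case/(comb_eq0 irr_cubic y_cubic)=> /eqP er /eqP es /eqP et.
move: er es et; rewrite !emb_eq0 // => /eqP + /eqP + /eqP t0.
by rewrite t0 mulr0 !mul0r !addr0 => + s0; rewrite s0 mul0r addr0.
Qed.

Lemma cubic_shift : (phi a + y) ^+ 3 = phi (3%:R * a) * (phi a + y) ^+ 2
  - phi (3%:R * a ^+ 2 - A) * (phi a + y) - phi (B - a * (a ^+ 2 - A)).
Proof. by move: y_cubic; rewrite -!phiE => yE; ring: yE. Qed.

End Shift.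

(** * Unit rank one *)

Section RankOne.
Variables (K : fieldType) (L : fieldExtType {fraction {poly K}}).

Lemma order_unit1 : order_unit (1 : L).
Proof.
split; first exact: integral1.
by exists 1; [exact: integral1 | rewrite mulr1].
Qed.

Lemma order_unitM (u v : L) :
  order_unit u -> order_unit v -> order_unit (u * v).
Proof.
move=> [int_u [u' int_u' uu']] [int_v [v' int_v' vv']].
split; first exact: integral_mul.
by exists (u' * v'); [exact: integral_mul | rewrite mulrACA uu' vv' mulr1].
Qed.

Lemma order_unitV (u : L) : order_unit u -> order_unit u^-1.
Proof.
move=> [int_u [v int_v uv]].
have u0 : u != 0.
  by apply: contra_eq_neq uv => ->; rewrite mul0r eq_sym oner_eq0.
have -> : u^-1 = v by apply: (mulfI u0); rewrite mulfV.
by split=> //; exists u => //; rewrite mulrC.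
Qed.

Lemma order_unit_exp (u : L) (k : int) : order_unit u -> order_unit (u ^ k).
Proof.
move=> unit_u; have unit_n n : order_unit (u ^+ n).
  elim: n => [|n IH]; first exact: order_unit1.
  by rewrite exprS; apply: order_unitM.
by case: k => n; [exact: unit_n | apply: order_unitV; exact: unit_n].
Qed.

Lemma fundamental_unit_rank1 (u : L) : fundamental_unit u ->
    (forall (k : int) (c : K), u ^ k = const_emb L c -> k = 0) ->
  has_unit_rank L 1.
Proof.
move=> [unit_u gen_u] free_u.
have u0 : u != 0.
  case: unit_u => _ [v _ uv]; apply: contra_eq_neq uv => ->.
  by rewrite mul0r eq_sym oner_eq0.
exists (fun v => exists k : int, v = u ^ k); split.
- split.
  + by move=> _ [k ->]; apply: order_unit_exp.
  + by exists 0.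
  + by move=> _ _ [k ->] [l ->]; exists (k + l); rewrite expfzDr.
  + by move=> _ [k ->]; exists (- k); rewrite invr_expz.
- move=> v /gen_u[c c0 [k ->]].
  by exists c => //; exists (u ^ k) => //; exists k.
- move=> c [k cE]; have k0 := free_u k c (esym cE).
  by move: cE; rewrite k0 expr0z -(rmorph1 (const_emb L)) => /fmorph_inj.
exists (fun=> u); split; first by exists 1.
move=> _ [k ->]; exists [ffun=> k]; split; first by rewrite big_ord1 ffunE.
move=> l; rewrite big_ord1 => kl; apply/ffunP=> i; rewrite ffunE (ord1 i).
apply/eqP; rewrite -subr_eq0; apply/eqP/(free_u _ 1).
by rewrite rmorph1 expfzDr // -invr_expz kl mulfV // expfz_eq0 negb_and u0 orbT.
Qed.

End RankOne.

(** An element with a constant power is algebraic over the constants. *)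
Lemma power_const_exp0 (K : fieldType) (L : fieldExtType {fraction {poly K}})
    (u : L) : const_field_closed L -> (forall c, u <> const_emb L c) ->
  forall (k : int) (c : K), u ^ k = const_emb L c -> k = 0.
Proof.
move=> closed u_nonconst.
have no_pow n c : u ^+ n.+1 <> const_emb L c.
  move=> unc; have [|c' uc'] := closed u; last exact: u_nonconst uc'.
  exists ('X^(n.+1) - c%:P); first by rewrite -size_poly_eq0 size_XnsubC.
  by apply/rootP; rewrite rmorphB /= map_polyXn map_polyC !hornerE unc subrr.
case=> [[|n]|n] c //; first by move/no_pow.
move=> /(congr1 (@GRing.inv L)); rewrite NegzE -exprnN invrK -fmorphV.
by move/no_pow.
Qed.

Theorem theorem2p4p6
  (Fq : finFieldType) (p : nat) (hchar : p \in [pchar Fq]) (hp : (5 <= p)%N)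
  (hq : (#|Fq|%:Z = -1 %[mod 3])%Z)
  (A a B D D1 D2 : {poly Fq}) (n1 : nat) (kappa : Fq)
  (hA : (size A).-1 = n1)
  (ha : (n1 < 2 * (size a).-1)%N)
  (hkappa : kappa != 0)
  (hB : B = a * (a ^+ 2 - A) + kappa%:P)
  (hD : D = 4%:R * A ^+ 3 - 27%:R * B ^+ 2)
  (hsqf : squarefree_factorization D D1 D2)
  (hD2B : D2 %| B)
  (hirr : irreducible_poly
    ('X^3 - (tofrac A)%:P * 'X + (tofrac B)%:P : {poly {fraction {poly Fq}}}))
  (L : fieldExtType {fraction {poly Fq}}) (y : L)
  (hgen : (<<1; y>> = fullv)%VS)
  (hy : y ^+ 3 = poly_emb L A * y - poly_emb L B)
  (hconst : const_field_closed L) :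
  has_unit_rank L 1 /\ fundamental_unit (poly_emb L a + y).
Proof.
have char_nat k : (0 < k < 5)%N -> k%:R != 0 :> Fq.
  move=> /andP[k0 k5]; rewrite -(dvdn_pcharf hchar) gtnNdvd //.
  exact: leq_trans hp.
have card3 : (#|Fq| %% 3)%N = 2.
  by move/eqP: hq; rewrite modz_nat eqz_nat => /eqP.
have aniso Y Z :=
  card_mod3_anisotropic (Y := Y) (Z := Z) (char_nat 3%N isT) card3.
pose emb : {rmorphism {poly Fq} -> {fraction {poly Fq}}} := @tofrac {poly Fq}.
have emb_inj : injective emb by move=> f g /eqP; rewrite tofrac_eq => /eqP.
have emb_frac u : exists n d, d != 0 /\ u = emb n / emb d := fraction_div u.
have size_a : (1 < size a)%N by move: ha; case: (size a) => [|[|k]].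
have size_A : (size A < size (a ^+ 2)%R)%N.
  have a0 : a != 0 by rewrite -size_poly_gt0 ltnW.
  rewrite expr2 size_mul //; move: hA ha size_a.
  by move: (size A) (size a) => x z *; lia.
rewrite hD in hsqf.
have int_comb (z : L) : in_max_order z -> in_order emb y z.
  exact: (@integral_in_order Fq _ emb emb_inj emb_frac (char_nat 2%N isT)
    L A B y hirr hgen hy D1 D2 hsqf hD2B z).
set e := poly_emb L a + y.
have free_e r s t :
    quadratic (poly_emb L) e r s t = 0 -> [/\ r = 0, s = 0 & t = 0].
  exact: (@free_shift _ _ emb emb_inj L A B y hirr hy
    (poly_emb L) a (fun=> erefl)).
have e_cubic : e ^+ 3 = poly_emb L (3%:R * a) * e ^+ 2
    - poly_emb L (3%:R * a ^+ 2 - A) * e - poly_emb L kappa%:P.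
  rewrite [e ^+ 3](cubic_shift (emb := emb) hy) //.
  by congr (_ - poly_emb L _); rewrite hB addrC addKr.
have int_y : in_max_order y := integral_y (emb := emb) hy.
have int_emb f : in_max_order (poly_emb L f) by exact: integral_id.
have int_e : in_max_order e by exact: integral_add (int_emb a) int_y.
have unit_e : order_unit e.
  (* The cubic equation divided by e gives e^-1. *)
  split=> //; exists (poly_emb L (- kappa^-1)%:P *
    (e * (e - poly_emb L (3%:R * a)) + poly_emb L (3%:R * a ^+ 2 - A))).
    exact: integral_mul (int_emb _) (integral_add
      (integral_mul int_e (integral_sub int_e (int_emb _))) (int_emb _)).
  have kK : poly_emb L (kappa^-1)%:P * poly_emb L kappa%:P = 1.
    by rewrite -rmorphM -polyCM mulVf // polyC1 rmorph1.
  by rewrite polyCN; ring: e_cubic kK.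
have e_fund : fundamental_unit e.
  split=> // v [int_v [v' int_v' vv']].
  have bdd w : in_max_order w -> exists n, bounded (poly_emb L) a e n w.
    move=> /int_comb[r [s [t ->]]].
    rewrite (comb_shift (phi := poly_emb L) y a) //.
    exact: bounded_elt.
  have [n bv] := bdd v int_v; have [n' bv'] := bdd v' int_v'.
  exact: (unit_power size_a size_A hkappa (char_nat 3%N isT) aniso free_e
    e_cubic bv bv' vv').
split=> //; apply: fundamental_unit_rank1 e_fund _.
apply: power_const_exp0 => // c ec.
have [] := free_e (- c%:P) 1 0.
  by rewrite /quadratic rmorph1 rmorph0 mul1r mul0r addr0 ec rmorphN addNr.
by move=> _ /eqP; rewrite oner_eq0.
Qed.
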